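(* Let $X$ be an infinite-dimensional Banach space and let $M \subsetneq X$ be an infinite-dimensional separable closed subspace. Then there is a bounded linear operator $T : X \to X$ that is $M$-hypercyclic.
   Context: For a bounded linear operator $T$ on a Banach space $X$ and $x \in X$, $\operatorname{orb}(x,T) := \{T^n x : n \geq 0\}$. Given a subspace $M \subsetneq X$, the operator $T$ is called $M$-hypercyclic if there is a vector $x \in X$ such that $\operatorname{orb}(x,T) \cap M$ is dense in $M$. The space $X$ is not assumed separable. *)

(* Defs.v *)
From HB Require Import structures.
From mathcomp Require Import all_boot all_order all_algebra.
From mathcomp Require Import complex.
From mathcomp Require Import all_classical all_reals all_analysis.

Set Implicit Arguments.
Unset Strict Implicit.
Unset Printing Implicit Defensive.

Import Order.TTheory GRing.Theory Num.Theory.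
Import numFieldNormedType.Exports.

Local Open Scope classical_set_scope.
Local Open Scope ring_scope.

(* The scalar field of a Banach space is the field of real numbers or the field
   of complex numbers; a Banach space over such a K is a
   [completeNormedModType K]. *)
Variant real_or_complex : numFieldType -> Prop :=
| real_scalars (R : realType) : real_or_complex R
| complex_scalars (R : realType) : real_or_complex (complex R).

Definition linear_subspace (K : numFieldType) (X : normedModType K)
    (M : set X) : Prop :=
  GRing.submod_closed [in M].

Definition finite_dimensional (K : numFieldType) (X : normedModType K)
    (M : set X) : Prop :=
  exists (n : nat) (e : 'I_n -> X),
    (forall i, M (e i)) /\
    (forall x, M x -> exists c : 'I_n -> K, x = \sum_(i < n) c i *: e i).

Definition infinite_dimensional (K : numFieldType) (X : normedModType K)
    (M : set X) : Prop :=
  ~ finite_dimensional M.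

Definition dense_in (X : topologicalType) (M D : set X) : Prop :=
  D `<=` M /\ M `<=` closure D.

Definition separable_set (X : topologicalType) (M : set X) : Prop :=
  exists D : set X, countable D /\ dense_in M D.

(* When K is complex, the inequality in K forces C to be real as soon as X is
   nonzero. *)
Definition bounded_operator (K : numFieldType) (X : normedModType K)
    (T : {linear X -> X}) : Prop :=
  exists C : K, forall x : X, `|T x| <= C * `|x|.

Definition orb (X : Type) (x : X) (T : X -> X) : set X :=
  [set iter n T x | n in [set: nat]].

Definition M_hypercyclic (K : numFieldType) (X : normedModType K)
    (M : set X) (T : X -> X) : Prop :=
  exists x : X, dense_in M (orb x T `&` M).

(* Main.v *)
Require Import Defs.
From HB Require Import structures.
From mathcomp Require Import all_boot all_order all_algebra.
From mathcomp Require Import complex.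
From mathcomp Require Import all_classical all_reals all_analysis.
From mathcomp Require Import zify ring lra.

Set Implicit Arguments.
Unset Strict Implicit.
Unset Printing Implicit Defensive.

Import Order.TTheory GRing.Theory Num.Theory.
Import numFieldNormedType.Exports.

Local Open Scope classical_set_scope.
Local Open Scope ring_scope.

(** The operator is the identity plus a nuclear operator, and on a dense
    subspace of M it acts as the translation p(X) |-> p(X + 1) of polynomials.

    Let e_0, e_1, ... be vectors of M whose span is dense in M, let f_0, f_1, ...
    be continuous functionals on X with f_n(e_m) = 1 if n = m and 0 otherwise,
    and put g_n := \sum_(k < n) 'C(n, k) e_k. Multiplying e_n by a large scalar and
    f_n by its inverse changes neither biorthogonality nor g_n, so that the f_n
    can be taken small enough for the series
        T x := x + \sum_n f_n(x) g_n
    to converge geometrically ([biorthogonal_system], [nuclear_perturbation]).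
    Then T is bounded on X, it maps the closed subspace M into itself, and
    T e_n = e_n + g_n; under the linear map that sends 'X^n to e_n
    ([poly_comb]), this says exactly that T is the translation by 1. The
    functionals have to live on X although the e_n lie in M, hence the only
    nonelementary ingredient is the Hahn-Banach theorem, in the weak form that
    continuous functionals separate the points of X
    ([bounded_functional_separation]).

    The translations of polynomials are topologically transitive whatever the
    vectors e_n are. Given u and v, a large even N and t = 1/n, consider
        p := u (1 - (t X)^N)^N + v(X - n) (1 - (t (X - n))^N)^N.
    As n grows, p tends coefficientwise to u, and p(X + n) tends to v. Indeed
    the cut-off factor (1 - (t X)^N)^N tends to 1, but it vanishes to order N at
    n, which beats the growth of u(X + n): the translate by n of the first
    summand is a polynomial in X and t that is divisible by t
    ([bump_translate_horner], [poly_comb_transitive]).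

    So every combination of the e_n can be moved slightly in such a way that its
    orbit comes close to any other one. A nested sequence of balls then closes
    in on a vector x of M whose orbit passes within 1/2^j of the j-th term of a
    sequence that visits each point of a countable dense subset of M infinitely
    often ([hitting_vector]). Every T^n x lies in M, so the orbit is dense in
    M. *)

(** * The Hahn-Banach theorem *)

Section Sublinear.
(* The real scalars act on V through iota, which covers at once the real vector
   spaces and the complex ones seen as real. *)
Variables (R : realType) (K : pzRingType) (iota : {rmorphism R -> K}).
Variable V : lmodType K.

Definition sublinear (q : V -> R) :=
  (forall x y, q (x + y) <= q x + q y) /\
  (forall a x, 0 < a -> q (iota a *: x) <= a * q x).

Lemma sublinearZ q a x : sublinear q -> 0 < a -> q (iota a *: x) = a * q x.
Proof.
move=> [_ qZ] a0; apply/eqP; rewrite eq_le qZ//=.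
have a'0 : 0 < a^-1 by rewrite invr_gt0.
have := qZ _ (iota a *: x) a'0.
by rewrite scalerA -rmorphM mulVf ?gt_eqF// rmorph1 scale1r ler_pdivlMl.
Qed.

Lemma sublinear0 q : sublinear q -> q 0 = 0.
Proof.
move=> sq; have /= := @sublinearZ q 2 0 sq (@ltr0Sn R 1).
by rewrite scaler0; lra.
Qed.

Lemma sublinear_opp q x : sublinear q -> - q (- x) <= q x.
Proof.
move=> sq; have [qD _] := sq; have := qD x (- x).
by rewrite subrr sublinear0//; lra.
Qed.

(** For a sublinear q, the largest sublinear functional below q whose value at
    - x0 is - q x0, the least that sublinearity allows. *)
Definition steepen (q : V -> R) (x0 x : V) : R :=
  inf [set q (x + iota t *: x0) - t * q x0 | t in [set t | 0 <= t]].

Section Steepen.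
Variables (q : V -> R) (x0 : V).
Hypothesis sq : sublinear q.

Lemma steepen_le x t : 0 <= t ->
  steepen q x0 x <= q (x + iota t *: x0) - t * q x0.
Proof.
move=> t0; apply: ge_inf; last by exists t.
exists (- q (- x)) => _ [s /= s0 <-].
have -> : s * q x0 = q (iota s *: x0).
  move: s0; rewrite le_eqVlt => /orP[/eqP <-|s0]; last by rewrite sublinearZ.
  by rewrite rmorph0 scale0r mul0r sublinear0.
have := sq.1 (x + iota s *: x0) (- x); rewrite addrAC subrr add0r.
lra.
Qed.

Lemma le_steepen x b :
  (forall t, 0 <= t -> b <= q (x + iota t *: x0) - t * q x0) ->
  b <= steepen q x0 x.
Proof.
move=> h; apply: lb_le_inf; last by move=> _ [t /= t0 <-]; exact: h.
by exists (q (x + iota 0 *: x0) - 0 * q x0); exists 0 => /=.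
Qed.

Lemma steepen_le_id x : steepen q x0 x <= q x.
Proof.
by have := @steepen_le x 0 (lexx _); rewrite rmorph0 scale0r addr0 mul0r subr0.
Qed.

Lemma steepen_opp : steepen q x0 (- x0) <= - q x0.
Proof.
have := @steepen_le (- x0) 1 ler01.
by rewrite rmorph1 scale1r addNr sublinear0// mul1r sub0r.
Qed.

Lemma steepen_sublinear : sublinear (steepen q x0).
Proof.
split=> [x y|a x a0].
  rewrite -lerBlDr; apply: le_steepen => s s0.
  rewrite lerBlDl -lerBlDr; apply: le_steepen => t t0.
  have := @steepen_le (x + y) (s + t) (addr_ge0 s0 t0).
  have := sq.1 (x + iota s *: x0) (y + iota t *: x0).
  rewrite addrACA -scalerDl -rmorphD; lra.
rewrite -ler_pdivrMl//; apply: le_steepen => t t0.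
rewrite ler_pdivrMl//.
have := @steepen_le (iota a *: x) (a * t) (mulr_ge0 (ltW a0) t0).
by rewrite rmorphM -scalerA -scalerDr (sublinearZ _ sq a0) mulrBr mulrA.
Qed.

End Steepen.

(** Zorn's lemma applies because the pointwise infimum of a chain of sublinear
    functionals is again sublinear: of two members of the chain one lies below
    the other, which gives subadditivity, and the members below p are bounded
    below by - p (- x). *)
Lemma minimal_sublinear p : sublinear p ->
  exists q, [/\ sublinear q, forall x, q x <= p x &
    forall q', sublinear q' -> (forall x, q' x <= q x) ->
      forall x, q x <= q' x].
Proof.
move=> sp.
pose T := {q : V -> R | sublinear q /\ forall x, q x <= p x}.
pose ord (q1 q2 : T) := `[< forall x, sval q2 x <= sval q1 x >].
have pT : sublinear p /\ forall x, p x <= p x by [].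
have [||A Atot|[q [sq qp]] qmin] := @ZL_preorder T (exist _ p pT) ord.
- by move=> t; apply/asboolP.
- move=> r s t /asboolP rs /asboolP st; apply/asboolP => x.
  exact: le_trans (st x) (rs x).
- have [[q0 Aq0]|A0] := pselect (exists q0, A q0); last first.
    by exists (exist _ p pT) => s As; case: A0; exists s.
  pose m x := inf [set sval q x | q in A].
  have mle q x : A q -> m x <= sval q x.
    move=> Aq; apply: ge_inf; last by exists q.
    exists (- p (- x)) => _ [[r [sr rp]] /= _ <-].
    by have := sublinear_opp x sr; have := rp (- x); lra.
  have lem b x : (forall q, A q -> b <= sval q x) -> b <= m x.
    move=> h; apply: lb_le_inf; first by exists (sval q0 x); exists q0.
    by move=> _ [q Aq <-]; exact: h.
  have sm : sublinear m.
    split=> [x y|a x a0].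
      rewrite -lerBlDr; apply: (lem (m (x + y) - m y)) => q1 Aq1.
      rewrite lerBlDl -lerBlDr; apply: lem => q2 Aq2.
      rewrite lerBlDr.
      have [/asboolP le12|/asboolP le21] := Atot _ _ Aq1 Aq2.
        have := mle _ (x + y) Aq2; have := (svalP q2).1.1 x y; have := le12 x.
        lra.
      have := mle _ (x + y) Aq1; have := (svalP q1).1.1 x y; have := le21 y.
      lra.
    rewrite -ler_pdivrMl//; apply: lem => q1 Aq1.
    rewrite ler_pdivrMl//; apply: le_trans (mle _ _ Aq1) _.
    exact: (svalP q1).1.2.
  have mp x : m x <= p x.
    by apply: le_trans (mle _ _ Aq0) _; exact: (svalP q0).2.
  exists (exist _ m (conj sm mp)) => q Aq.
  by apply/asboolP => x; exact: mle.
- exists q; split=> // q' sq' q'q.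
  have q'p x : q' x <= p x by exact: le_trans (q'q x) (qp x).
  have /qmin /asboolP// :
    ord (exist _ q (conj sq qp)) (exist _ q' (conj sq' q'p)).
  exact/asboolP.
Qed.

(** A minimal sublinear functional g is linear: minimality gives
    g <= steepen g x, hence g (- x) <= - g x, and an odd subadditive functional
    is additive. Starting below steepen p x0 rather than below p forces the
    value at x0. *)
Lemma hahn_banach p x0 : sublinear p ->
  exists g : V -> R, [/\ forall x y, g (x + y) = g x + g y,
    forall a x, g (iota a *: x) = a * g x,
    forall x, g x <= p x & p x0 <= g x0].
Proof.
move=> sp.
have [g [sg gp gmin]] := minimal_sublinear (steepen_sublinear x0 sp).
have gN x : g (- x) = - g x.
  apply/eqP; rewrite eq_le; apply/andP; split.
    apply: le_trans (steepen_opp x sg).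
    apply: gmin; first exact: steepen_sublinear.
    by move=> y; exact: steepen_le_id.
  by have := sublinear_opp (- x) sg; rewrite opprK.
exists g; split.
- move=> x y; apply/eqP; rewrite eq_le sg.1/=.
  by have := sg.1 (- x) (- y); rewrite -opprD !gN; lra.
- move=> a x; have [a0|a0|->] := ltgtP a 0; last first.
  + by rewrite rmorph0 scale0r mul0r sublinear0.
  + exact: sublinearZ.
  + rewrite -[a]opprK rmorphN scaleNr gN sublinearZ ?oppr_gt0//.
    by rewrite !mulNr.
- by move=> x; apply: le_trans (gp x) _; exact: steepen_le_id.
- have := gp (- x0); have := steepen_opp x0 sp; rewrite gN; lra.
Qed.

End Sublinear.

Definition bounded_functional (K : numFieldType) (X : normedModType K)
    (f : X -> K) :=
  scalar f /\ exists2 C : K, 0 < C & forall x, `|f x| <= C * `|x|.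

Lemma real_or_complex_archimedean (K : numFieldType) : real_or_complex K ->
  forall x : K, 0 <= x -> exists n : nat, x < n%:R.
Proof.
case=> R x x0; first by exists (Num.bound x); exact: archi_boundP.
have E : x = (complex.Re x)%:C%C.
  by rewrite [LHS]complexE (ger0_Im x0) mulr0 addr0.
have r0 : 0 <= complex.Re x by rewrite -ler0c -E.
exists (Num.bound (complex.Re x)); rewrite E.
rewrite -(rmorph_nat (real_complex R)) ltcR.
exact: archi_boundP.
Qed.

(** In the complex case a real-linear g is the real part of the complex-linear
    functional x |-> g x - i g (i x). *)
Lemma bounded_functional_separation (K : numFieldType) (X : normedModType K) :
  real_or_complex K ->
  forall x0 : X, x0 != 0 -> exists2 f : X -> K, bounded_functional f & f x0 = 1.
Proof.
move=> hK.
suff H (x0 : X) : x0 != 0 ->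
    exists2 f : X -> K, bounded_functional f & f x0 != 0.
  move=> x0 /H[f [fl [C C0 fC]] fx0].
  exists (fun x => (f x0)^-1 * f x); last first.
    by rewrite mulVf.
  split; first by move=> a u v /=; rewrite fl mulrDr mulrCA.
  exists (`|f x0|^-1 * C); first by rewrite mulr_gt0// invr_gt0 normr_gt0.
  by move=> x; rewrite normrM normfV -mulrA ler_pM2l ?invr_gt0 ?normr_gt0.
case: hK X x0 => R X x0 x0n.
  have sp : @sublinear R R idfun X (fun x => `|x|).
    split=> [x y|a x a0]; first exact: ler_normD.
    by rewrite normrZ gtr0_norm.
  have [g [gD gZ gp gx0]] := hahn_banach x0 sp.
  exists g; last by rewrite gt_eqF// (lt_le_trans _ gx0)// normr_gt0.
  split; first by move=> a x y; rewrite gD gZ.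
  exists 1 => // x; rewrite mul1r ler_norml gp andbT.
  have := gp (-1 *: x); rewrite (gZ (-1) x) normrZ normrN1 mul1r mulN1r; lra.
pose p (x : X) := complex.Re `|x|.
have pE x : `|x| = (p x)%:C%C.
  by rewrite [LHS]complexE ger0_Im ?mulr0 ?addr0.
have sp : sublinear (real_complex R) p.
  split=> [x y|a x a0].
    by rewrite -lecR rmorphD/= -!pE; exact: ler_normD.
  rewrite -lecR rmorphM/= -!pE normrZ ger0_norm// ler0c; exact: ltW.
have [g [gD gZ gp gx0]] := hahn_banach x0 sp.
pose f (x : X) : R[i]%C := ((g x)%:C - 'i * (g ('i%C *: x))%:C)%C.
exists f; last first.
  apply/eqP => /(congr1 (@complex.Re R)) /=.
  have p0 : 0 < p x0 by rewrite -ltcR -pE normr_gt0.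
  by lra.
have realC (r : R) : `|r%:C%C| = (`|r|)%:C%C :> R[i]%C.
  by rewrite normc_def /= expr0n addr0 sqrtr_sqr.
have gN x : `|g x| <= p x.
  rewrite ler_norml gp andbT; have := gp (-1 *: x).
  have -> : -1 *: x = (-1 : R)%:C%C *: x by rewrite rmorphN1.
  rewrite gZ /p normrZ realC normrN1 mul1r; lra.
have norm_i : `|'i%C| = 1 :> R[i]%C.
  by rewrite normc_def /= expr0n expr1n add0r sqrtr1.
have p_i x : p ('i%C *: x) = p x by rewrite /p normrZ norm_i mul1r.
split.
  move=> a u v; rewrite /f.
  have gC (b : R[i]%C) w :
      g (b *: w) = complex.Re b * g w + complex.Im b * g ('i%C *: w).
    by rewrite {1}[b]complexE scalerDl gD gZ ['i%C * _]mulrC -scalerA gZ.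
  rewrite scalerDr scalerA !gD (gC a) (gC ('i%C * a)).
  case: a => a b /=; apply/eqP; rewrite eq_complex /=.
  by apply/andP; split; apply/eqP; ring.
exists 2 => // x; rewrite /f; apply: le_trans (ler_normB _ _) _.
rewrite normrM norm_i mul1r !realC.
rewrite pE -(rmorph_nat (real_complex R)) -rmorphM -rmorphD lecR.
by have := gN x; have := gN ('i%C *: x); rewrite p_i; lra.
Qed.

(** * Geometrically convergent sequences and nuclear perturbations *)

Section Geometric.
Variable K : numFieldType.
Hypothesis arch : forall x : K, 0 <= x -> exists n : nat, x < n%:R.

Lemma half_expr_small (C e : K) : 0 <= C -> 0 < e ->
  exists N, forall n, (N <= n)%N -> C / 2 ^+ n < e.
Proof.
move=> C0 e0; have [N hN] := arch (divr_ge0 C0 (ltW e0)).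
exists N => n Nn; rewrite ltr_pdivrMr ?exprn_gt0//.
rewrite ltr_pdivrMr// mulrC in hN; apply: lt_le_trans hN _.
rewrite ler_pM2l// -natrX ler_nat (leq_trans Nn)// ltnW//; exact: ltn_expl.
Qed.

Lemma geometric_step_dist (X : normedModType K) (u : nat -> X) (C : K) :
  (forall n, `|u n.+1 - u n| <= C / 2 ^+ n) ->
  forall n m, `|u (n + m)%N - u n| <= 2 * C / 2 ^+ n.
Proof.
move=> du n m.
have C0 : 0 <= C by have := le_trans (normr_ge0 _) (du 0); rewrite expr0 divr1.
(* The exact value of the geometric sum makes the induction go through. *)
suff : `|u (n + m)%N - u n| <= 2 * C / 2 ^+ n - 2 * C / 2 ^+ (n + m).
  move/le_trans; apply; rewrite gerBl divr_ge0 ?exprn_ge0// mulr_ge0//.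
elim: m => [|m IH]; first by rewrite addn0 !subrr normr0.
rewrite addnS -(subrKA (u (n + m)%N)) (le_trans (ler_normD _ _))//.
rewrite (le_trans (lerD (du _) IH))// exprS invfM.
rewrite le_eqVlt; apply/orP; left; apply/eqP; field.
by rewrite !gt_eqF ?exprn_gt0 ?ltr0n.
Qed.

Lemma geometric_cvg (X : completeNormedModType K) (u : nat -> X) (C : K) :
  (forall n, `|u n.+1 - u n| <= C / 2 ^+ n) -> cvg (u @ \oo).
Proof.
move=> du.
have C0 : 0 <= C by have := le_trans (normr_ge0 _) (du 0); rewrite expr0 divr1.
apply: cauchy_cvg; apply: cauchy_exP => e e0.
have [N hN] := half_expr_small (mulr_ge0 (ler0n _ 2) C0) e0.
exists (u N); exists N => // n /= Nn; rewrite -ball_normE /= distrC.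
rewrite -(subnKC Nn); apply: le_lt_trans (geometric_step_dist du _ _) _.
exact: hN.
Qed.

Lemma geometric_lim_dist (X : normedModType K) (u : nat -> X) (l : X) (C : K) :
  (forall n, `|u n.+1 - u n| <= C / 2 ^+ n) -> u @ \oo --> l ->
  `|l - u 0| <= 2 * C.
Proof.
move=> du ul; apply/ler_addgt0Pr => e e0.
have [N _ /(_ N (leqnn N)) hN] := (@cvgrPdist_lt _ _ _ _ _ _ _).1 ul e e0.
rewrite [leRHS]addrC -(subrKA (u N)) (le_trans (ler_normD _ _))// lerD//.
  exact: ltW.
by have := geometric_step_dist du 0 N; rewrite add0n expr0 divr1.
Qed.

(** The partial sums at x satisfy the geometric bound with constant |x|, so that
    they converge to within 2 |x| of their first term x. *)
Lemma nuclear_perturbation (X : completeNormedModType K)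
    (f : nat -> X -> K) (g : nat -> X) :
  (forall k, scalar (f k)) ->
  (forall k x, `|f k x| * `|g k| <= `|x| / 2 ^+ k) ->
  exists T : {linear X -> X}, (forall x, `|T x| <= 3 * `|x|) /\
    forall x, (fun n => x + \sum_(k < n) f k x *: g k) @ \oo --> T x.
Proof.
move=> fl fg; pose S x n := x + \sum_(k < n) f k x *: g k.
have dS x n : `|S x n.+1 - S x n| <= `|x| / 2 ^+ n.
  by rewrite /S big_ord_recr /= addrA [X in `|X|]addrC addKr normrZ.
pose T x := lim (S x @ \oo).
have TS x : S x @ \oo --> T x by apply: (geometric_cvg (dS x)).
have Tl : linear T.
  move=> a x y; apply: cvg_lim => //.
  have -> : S (a *: x + y) = a *: S x + S y.
    apply/funext => n /=; rewrite /S !fctE.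
    rewrite scalerDr addrACA scaler_sumr -big_split /=; congr (_ + _).
    by apply: eq_bigr => k _; rewrite fl scalerDl scalerA.
  by apply: cvgD => //; apply: cvgZr.
pose lT := GRing.isLinear.Build K X X *:%R T Tl.
pose T' : {linear X -> X} := HB.pack T lT.
exists T'; split=> // x /=.
have := geometric_lim_dist (dS x) (TS x).
rewrite {1}/S big_ord0 addr0 => h.
rewrite -[T x](subrK x) (le_trans (ler_normD _ _))//.
have -> : 3 * `|x| = 2 * `|x| + `|x| by ring.
by rewrite lerD2r.
Qed.

End Geometric.

(** * Biorthogonal systems *)

(** Dependent choice in which every term may depend on all the earlier ones. *)
Lemma sequence_by_extension (A : Type) (Inv : seq A -> Prop)
    (P : seq A -> A -> Prop) :
  Inv [::] -> (forall s, Inv s -> exists a, Inv (rcons s a) /\ P s a) ->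
  exists F : nat -> A, forall n, Inv (mkseq F n) /\ P (mkseq F n) (F n).
Proof.
move=> Inv0 ext; have [a0 _] := ext _ Inv0.
have /choice[nxt nxtP] s : exists a, Inv s -> Inv (rcons s a) /\ P s a.
  have [/ext[a Pa]|nI] := pselect (Inv s); first by exists a.
  by exists a0.
pose st n := iter n (fun s => rcons s (nxt s)) [::].
have stE n : st n = mkseq (fun k => nxt (st k)) n.
  by elim: n => // n IH; rewrite mkseqS -IH.
exists (fun k => nxt (st k)) => n; rewrite -stE.
suff I : Inv (st n) by split=> //; have [] := nxtP _ I.
by elim: n => //= n /nxtP[].
Qed.

Section LinearSubspace.
Variables (K : numFieldType) (X : normedModType K) (M : set X).
Hypothesis Msub : linear_subspace M.

Lemma linear_subspaceD x y : M x -> M y -> M (x + y).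
Proof.
move=> Mx My; have := Msub.2 1 x y; rewrite scale1r !inE; exact.
Qed.

Lemma linear_subspace0 : M 0.
Proof. by have := Msub.1; rewrite inE. Qed.

Lemma linear_subspaceZ a x : M x -> M (a *: x).
Proof.
move=> Mx; have := Msub.2 a x 0; rewrite addr0 !inE; apply=> //.
exact: linear_subspace0.
Qed.

Lemma linear_subspace_sum n (c : nat -> K) (e : nat -> X) :
  (forall i, (i < n)%N -> M (e i)) -> M (\sum_(i < n) c i *: e i).
Proof.
move=> Me; elim: n Me => [|n IH] Me.
  by rewrite big_ord0; exact: linear_subspace0.
rewrite big_ord_recr /=; apply: linear_subspaceD.
  by apply: IH => i ni; apply: Me; exact: ltnW.
by apply: linear_subspaceZ; exact: Me.
Qed.

End LinearSubspace.

Section Biorthogonal.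
Variables (K : numFieldType) (X : normedModType K).

Lemma scalarform0 (f : X -> K) : scalar f -> f 0 = 0.
Proof.
by move=> fl; have := fl (-1) 0 0; rewrite scaler0 addr0 mulN1r addNr.
Qed.

Lemma scalarformZ (f : X -> K) a x : scalar f -> f (a *: x) = a * f x.
Proof.
by move=> fl; have := fl a x 0; rewrite !addr0 (scalarform0 fl) addr0.
Qed.

Lemma scalarform_sum (f : X -> K) n (c : nat -> K) (e : nat -> X) :
  scalar f -> f (\sum_(i < n) c i *: e i) = \sum_(i < n) c i * f (e i).
Proof.
move=> fl; elim: n => [|n IH]; first by rewrite !big_ord0 scalarform0.
by rewrite !big_ord_recr /= addrC fl IH addrC.
Qed.

Lemma bounded_functionalB_sum (n : nat) (f : X -> K) (h : nat -> X -> K)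
    (c : nat -> K) :
  bounded_functional f -> (forall i, (i < n)%N -> bounded_functional (h i)) ->
  bounded_functional (fun x => f x - \sum_(i < n) c i * h i x).
Proof.
move=> [fl [C C0 fC]]; elim: n => [|n IH] hb.
  split; first by move=> a u v; rewrite !big_ord0 !subr0 fl.
  by exists C => // x; rewrite big_ord0 subr0.
have [i ni|gl [D D0 gD]] := IH; first by apply: hb; exact: ltnW.
have [hl [E E0 hE]] := hb n (ltnSn n); split.
  move=> a u v; rewrite !big_ord_recr /= !opprD !addrA (gl a u v) (hl a u v).
  by ring.
exists (D + `|c n| * E) => [|x]; first by rewrite ltr_wpDr// mulr_ge0// ltW.
rewrite big_ord_recr /= opprD addrA (le_trans (ler_normB _ _))// mulrDl.
by rewrite lerD// normrM -mulrA ler_wpM2l.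
Qed.

(* The weight W s is how small the functional that follows the vectors s has to
   be made. *)
Variables (M : set X) (d : nat -> X) (W : seq X -> K).
Hypothesis sep : forall x0 : X, x0 != 0 ->
  exists2 f : X -> K, bounded_functional f & f x0 = 1.
Hypothesis Msub : linear_subspace M.
Hypothesis Minf : infinite_dimensional M.
Hypothesis Md : forall n, M (d n).
Hypothesis W0 : forall s, 0 <= W s.

(* A finite biorthogonal system is a sequence of pairs; a pair whose vector and
   functional are zero serves as the default beyond its end. *)
Let vec (s : seq (X * (X -> K))) i := (nth (0, fun=> 0) s i).1.
Let fct (s : seq (X * (X -> K))) i := (nth (0, fun=> 0) s i).2.

Let biorthogonal (s : seq (X * (X -> K))) :=
  [/\ forall i, (i < size s)%N -> M (vec s i),
      forall i, (i < size s)%N -> bounded_functional (fct s i) &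
      forall i j, (i < size s)%N -> (j < size s)%N ->
        fct s i (vec s j) = (i == j)%:R].

(** The difference y - proj y is killed by all the functionals of s. If t itself
    gives a nonzero difference, then x is that difference; otherwise t is
    already in the span of s, and M, not being finite-dimensional, contains some
    other y for which the difference is nonzero. *)
Lemma complementary_vector s t : biorthogonal s -> M t ->
  exists x, [/\ M x, x != 0, forall i, (i < size s)%N -> fct s i x = 0 &
    exists b (c : nat -> K), t = \sum_(i < size s) c i *: vec s i + b *: x].
Proof.
move=> [Ms bs os] Mt; set n := size s in Ms bs os *.
pose proj y := \sum_(i < n) fct s i y *: vec s i.
have Mproj y : M y -> M (y - proj y).
  move=> My; rewrite addrC -scaleN1r; apply: linear_subspaceD => //.
  apply: linear_subspaceZ => //.
  exact: (@linear_subspace_sum _ _ _ Msub n (fun i => fct s i y)).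
have kill y i : (i < n)%N -> fct s i (y - proj y) = 0.
  move=> ni; have [fl _] := bs _ ni.
  rewrite addrC -scaleN1r fl (@scalarform_sum _ n (fun j => fct s j y))//.
  rewrite (bigD1 (Ordinal ni))//= os// eqxx mulr1 big1 ?addr0 ?mulN1r ?addNr//.
  move=> j ji; rewrite os// eq_sym -[i in _ == i]/(val (Ordinal ni)) val_eqE.
  by rewrite (negbTE ji) mulr0.
have [tE|tn] := eqVneq (t - proj t) 0; last first.
  exists (t - proj t); split=> //; first exact: Mproj.
  - by move=> i; exact: kill.
  - by exists 1, (fun i => fct s i t); rewrite scale1r [RHS]addrC subrK.
have [y [My yn]] : exists y, M y /\ y - proj y != 0.
  apply: contrapT => noy; apply: Minf; exists n, (fun i : 'I_n => vec s i).
  split=> [i|y My]; first exact: Ms.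
  exists (fun i : 'I_n => fct s i y); apply/eqP; rewrite -subr_eq0.
  by apply: contrapT => /negP yn; apply: noy; exists y.
exists (y - proj y); split=> //; first exact: Mproj.
- by move=> i; exact: kill.
- exists 0, (fun i => fct s i t); rewrite scale0r addr0.
  by apply/eqP; rewrite -subr_eq0; apply/eqP.
Qed.

(** A functional g with g x = 1 comes to vanish on the vectors e_i of s when
    g(e_i) f_i is subtracted for each of them, and this does not change its
    value at x because the f_i kill x. Multiplying x by r and dividing the
    functional by r then makes the latter as small as wanted. *)
Lemma biorthogonal_extension s : biorthogonal s ->
  exists a : X * (X -> K), biorthogonal (rcons s a) /\
    (forall x, `|a.2 x| * W [seq u.1 | u <- s] <= `|x|) /\
    exists c : nat -> K, d (size s) =
      \sum_(i < (size s).+1) c i *: vec (rcons s a) i.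
Proof.
move=> bos.
have [x [Mx xn kx [b [c dE]]]] := complementary_vector bos (Md (size s)).
case: bos => Ms bs os; set n := size s in Ms bs os kx dE *.
have [g bg gx] := sep xn.
pose h y := g y - \sum_(i < n) g (vec s i) * fct s i y.
have [hl [C C0 hC]] : bounded_functional h.
  exact: (@bounded_functionalB_sum n _ _ (fun i => g (vec s i))).
have hx : h x = 1.
  by rewrite /h big1 ?subr0// => i _; rewrite kx// mulr0.
have hs j : (j < n)%N -> h (vec s j) = 0.
  move=> nj; rewrite /h (bigD1 (Ordinal nj))//= os// eqxx mulr1.
  rewrite big1 ?addr0 ?subrr// => i ij.
  rewrite os// -[j in _ == j]/(val (Ordinal nj)) val_eqE.
  by rewrite (negbTE ij) mulr0.
pose r := C * (1 + W [seq u.1 | u <- s]).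
have r0 : 0 < r by rewrite mulr_gt0// ltr_wpDr.
have rn : r != 0 by rewrite gt_eqF.
pose a : X * (X -> K) := (r *: x, fun y => r^-1 * h y).
have vecE i : (i < n)%N -> vec (rcons s a) i = vec s i.
  by move=> ni; rewrite /vec nth_rcons ni.
have fctE i : (i < n)%N -> fct (rcons s a) i = fct s i.
  by move=> ni; rewrite /fct nth_rcons ni.
have vecn : vec (rcons s a) n = r *: x by rewrite /vec nth_rcons ltnn eqxx.
have fctn : fct (rcons s a) n = fun y => r^-1 * h y.
  by rewrite /fct nth_rcons ltnn eqxx.
exists a; split; last split.
- split; rewrite size_rcons -/n.
  + move=> i; rewrite ltnS leq_eqVlt => /orP[/eqP->|ni].
      by rewrite vecn; exact: linear_subspaceZ.
    by rewrite vecE//; exact: Ms.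
  + move=> i; rewrite ltnS leq_eqVlt => /orP[/eqP->|ni].
      rewrite fctn; split; first by move=> u v w /=; rewrite hl; ring.
      exists (r^-1 * C); first by rewrite mulr_gt0// invr_gt0.
      move=> y; rewrite normrM gtr0_norm ?invr_gt0// -mulrA.
      by rewrite ler_pM2l ?invr_gt0.
    by rewrite fctE//; exact: bs.
  + move=> i j; rewrite !ltnS leq_eqVlt => /orP[/eqP->|ni];
      rewrite leq_eqVlt => /orP[/eqP->|nj].
    * by rewrite fctn vecn eqxx scalarformZ// hx mulr1 mulVf.
    * by rewrite fctn vecE// hs// mulr0 gtn_eqF.
    * have [fl _] := bs i ni.
      by rewrite fctE// vecn scalarformZ// kx// mulr0 ltn_eqF.
    * by rewrite fctE// vecE// os.
- move=> y /=; rewrite normrM gtr0_norm ?invr_gt0// -mulrA ler_pdivrMl//.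
  rewrite (le_trans (ler_wpM2r _ (hC y)))// /r mulrAC ler_wpM2r//.
  by rewrite ler_wpM2l ?(ltW C0)// ler_wpDl.
- exists (fun i => if i == n then b / r else c i).
  rewrite big_ord_recr /= eqxx vecn scalerA mulfVK// dE; congr (_ + _).
  by apply: eq_bigr => i _; rewrite vecE// ltn_eqF.
Qed.

(** The last clause makes the span of the e_n as large as prescribed: taking the
    d_n dense in M makes it dense in M. *)
Lemma biorthogonal_system : exists (e : nat -> X) (f : nat -> X -> K),
  [/\ forall n, M (e n),
      forall n, scalar (f n),
      forall n m, f n (e m) = (n == m)%:R,
      forall n x, `|f n x| * W (mkseq e n) <= `|x| &
      forall n, exists c : nat -> K, d n = \sum_(i < n.+1) c i *: e i].
Proof.
have [//|F FP] := sequence_by_extension _ biorthogonal_extension.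
have vecF n i : (i < n)%N -> vec (mkseq F n) i = (F i).1.
  by move=> ni; rewrite /vec nth_mkseq.
have fctF n i : (i < n)%N -> fct (mkseq F n) i = (F i).2.
  by move=> ni; rewrite /fct nth_mkseq.
exists (fun n => (F n).1), (fun n => (F n).2); split.
- move=> n; have [[+ _ _] _] := FP n.+1.
  by move=> /(_ n); rewrite size_mkseq vecF//; exact.
- move=> n; have [[_ + _] _] := FP n.+1.
  by move=> /(_ n); rewrite size_mkseq fctF// => /(_ (ltnSn n))[].
- move=> n m; have [[_ _ +] _] := FP (maxn n m).+1.
  move=> /(_ n m); rewrite size_mkseq fctF ?vecF ?ltnS ?leq_maxl ?leq_maxr//.
  exact.
- move=> n x; have [_ [+ _]] := FP n.
  by move=> /(_ x); rewrite /mkseq -map_comp.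
- move=> n; have [_ [_ [c]]] := FP n; rewrite size_mkseq -mkseqS => dE.
  exists c; rewrite dE; apply: eq_bigr => i _; by rewrite vecF.
Qed.
End Biorthogonal.

(** * Translation of polynomials *)

Section PolynomialCombination.
Variables (K : numFieldType) (X : normedModType K) (e : nat -> X).

Definition poly_comb (p : {poly K}) : X := \sum_(i < size p) p`_i *: e i.

Lemma poly_combE n (p : {poly K}) : (size p <= n)%N ->
  poly_comb p = \sum_(i < n) p`_i *: e i.
Proof.
move=> pn; rewrite /poly_comb (big_ord_widen n (fun i => p`_i *: e i))//.
rewrite big_mkcond; apply: eq_bigr => i _; case: ltnP => // /(nth_default 0)->.
by rewrite scale0r.
Qed.

Lemma poly_comb_is_linear : linear poly_comb.
Proof.
move=> a p q; pose n := maxn (size (a *: p + q)%R) (maxn (size p) (size q)).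
rewrite !(@poly_combE n) ?leq_max ?leqnn ?orbT// scaler_sumr -big_split /=.
by apply: eq_bigr => i _; rewrite coefD coefZ scalerDl scalerA.
Qed.

HB.instance Definition _ :=
  GRing.isLinear.Build K {poly K} X *:%R poly_comb poly_comb_is_linear.

Lemma poly_combXn n : poly_comb 'X^n = e n.
Proof.
rewrite (@poly_combE n.+1) ?size_polyXn// big_ord_recr /= coefXn eqxx scale1r.
by rewrite big1 ?add0r// => i _; rewrite coefXn ltn_eqF// scale0r.
Qed.

Lemma poly_comb_translate (T : {linear X -> X}) :
  (forall n, T (e n) = \sum_(k < n.+1) 'C(n, k)%:R *: e k) ->
  forall p, T (poly_comb p) = poly_comb (p \Po ('X + 1)).
Proof.
move=> Te p; rewrite /poly_comb linear_sum -/(poly_comb _) comp_polyE.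
rewrite linear_sum.
apply: eq_bigr => i _; rewrite !linearZ /= Te addrC exprDn.
congr (_ *: _); rewrite linear_sum; apply: eq_bigr => k _.
by rewrite expr1n mul1r raddfMn /= poly_combXn scaler_nat.
Qed.

Lemma poly_comb_translate_iter (T : {linear X -> X}) :
  (forall n, T (e n) = \sum_(k < n.+1) 'C(n, k)%:R *: e k) ->
  forall n p, iter n T (poly_comb p) = poly_comb (p \Po ('X + n%:R%:P)).
Proof.
move=> Te; elim=> [|n IH] p /=; first by rewrite addr0 comp_polyXr.
rewrite IH poly_comb_translate// -comp_polyA comp_polyD comp_polyX comp_polyC.
by rewrite -addrA -natr1 [in RHS]rmorphD/= [1 + _]addrC.
Qed.

(** Convergence of polynomials as t tends to 0 is phrased through bivariate
    polynomials Q: whatever the vectors e_n, Q.[t%:P] tends to Q.[0] at speed t,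
    because the difference is t times a polynomial in X and t. *)
Lemma poly_comb_horner_lipschitz0 (Q : {poly {poly K}}) :
  exists2 C : K, 0 <= C &
  forall t : K, `|t| <= 1 ->
    `|poly_comb Q.[t%:P] - poly_comb Q.[0]| <= C * `|t|.
Proof.
elim/poly_ind: Q => [|Q c [C C0 IH]].
  by exists 0 => // t _; rewrite !horner0 subrr normr0 mul0r.
exists (`|poly_comb Q.[0]| + C) => [|t t1]; first by rewrite addr_ge0.
rewrite !hornerMXaddC mulr0 add0r -linearB /= addrK mulrC mul_polyC linearZ /=.
rewrite normrZ mulrC ler_wpM2r//.
rewrite -[poly_comb _](subrK (poly_comb Q.[0])) (le_trans (ler_normD _ _))//.
rewrite addrC lerD2l (le_trans (IH t t1))// -[leRHS]mulr1.
exact: ler_wpM2l.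
Qed.

End PolynomialCombination.

(** * Topological transitivity of the translation *)

Section Bump.
Variable K : numFieldType.

(** For small t the cut-off factor is close to 1 at bounded distance from 0, and
    it vanishes to order N at 1/t. *)
Definition bump (N : nat) (t : K) (u : {poly K}) : {poly K} :=
  u * (1 - (t%:P * 'X) ^+ N) ^+ N.

Lemma bump_horner N (u : {poly K}) : (0 < N)%N ->
  exists2 Q : {poly {poly K}}, Q.[0] = u & forall t, bump N t u = Q.[t%:P].
Proof.
move=> N0; exists (u%:P * (1 - ('X * ('X)%:P) ^+ N) ^+ N) => [|t]; last first.
  by rewrite /bump !(hornerM, hornerD, hornerN, horner_exp, hornerC, hornerX).
rewrite !(hornerM, hornerD, hornerN, horner_exp, hornerC, hornerX).
by rewrite mul0r expr0n gtn_eqF// subr0 expr1n mulr1.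
Qed.

(** Translating by 1/t turns the cut-off factor into (1 - (t X + 1)^N)^N, which
    is divisible by t^N; as t^N u(X + 1/t) is t times a polynomial in X and t
    when the degree of u is less than N, the whole is such a multiple too. *)
Lemma bump_translate_horner N (u : {poly K}) : (size u <= N)%N ->
  exists2 Q : {poly {poly K}}, Q.[0] = 0 &
    forall t, t != 0 -> bump N t u \Po ('X + t^-1%:P) = Q.[t%:P].
Proof.
move=> uN.
pose Q1 : {poly {poly K}} :=
  \sum_(i < size u) (u`_i)%:P%:P * ('X * 'X%:P + 1) ^+ i * 'X ^+ (N.-1 - i).
pose Q2 : {poly {poly K}} := - ('X%:P * \sum_(i < N) ('X * 'X%:P + 1) ^+ i).
exists ('X * (Q1 * Q2 ^+ N)) => [|t t0]; first by rewrite hornerM hornerX mul0r.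
have Q1E : 'X * Q1 = \sum_(i < size u)
    (u`_i)%:P%:P * ('X * 'X%:P + 1) ^+ i * 'X ^+ (N - i).
  rewrite mulr_sumr; apply: eq_bigr => i _; rewrite mulrCA; congr (_ * _).
  rewrite -exprS; congr (_ ^+ _); have := ltn_ord i; lia.
have tX : t%:P * ('X + t^-1%:P) = t%:P * 'X + 1 :> {poly K}.
  by rewrite mulrDr -polyCM mulfV.
have E1 : t%:P ^+ N * (u \Po ('X + t^-1%:P)) = ('X * Q1).[t%:P].
  rewrite Q1E horner_sum comp_polyE mulr_sumr; apply: eq_bigr => i _.
  rewrite !(hornerM, hornerD, horner_exp, hornerC, hornerX).
  rewrite -mul_polyC -tX exprMn.
  rewrite -[in LHS](subnKC (ltnW (leq_trans (ltn_ord i) uN))) exprD; ring.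
have E2 : 1 - (t%:P * 'X + 1) ^+ N = t%:P * Q2.[t%:P].
  rewrite -opprB subrX1 addrK /Q2 hornerN hornerM horner_sum mulrN mulrA.
  rewrite hornerC; congr (- (_ * _)); apply: eq_bigr => i _.
  by rewrite !(hornerM, hornerD, horner_exp, hornerC, hornerX).
rewrite /bump comp_polyM rmorphXn rmorphB rmorph1 rmorphXn rmorphM /=.
rewrite comp_polyC comp_polyX tX E2 exprMn mulrCA mulrA E1 mulrA.
by rewrite [in RHS]hornerM horner_exp.
Qed.

Lemma bumpN N t u : ~~ odd N -> bump N (- t) u = bump N t u.
Proof.
by move=> oN; rewrite /bump polyCN mulNr exprNn -signr_odd (negbTE oN) mul1r.
Qed.

Hypothesis arch : forall x : K, 0 <= x -> exists n : nat, x < n%:R.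

(** The witness is bump N t u + (bump N t v)(X - n) with t = 1/n. Evenness of N
    lets the second bump be read at - t, where X - n is X + 1/(- t), so that
    [bump_translate_horner] applies to both directions of translation. *)
Lemma poly_comb_transitive (X : normedModType K) (e : nat -> X)
    (u v : {poly K}) (eps : K) : 0 < eps ->
  exists (n : nat) (p : {poly K}),
    `|poly_comb e p - poly_comb e u| < eps /\
    `|poly_comb e (p \Po ('X + n%:R%:P)) - poly_comb e v| < eps.
Proof.
move=> eps0; pose N := (size u + size v).+1.*2.
have N0 : (0 < N)%N by [].
have [uN vN] : (size u <= N)%N /\ (size v <= N)%N by rewrite /N; lia.
have oN : ~~ odd N by rewrite odd_double.
have [Q Q0 QE] := bump_horner u N0.
have [Q' Q'0 Q'E] := bump_translate_horner uN.
have [S S0 SE] := bump_horner v N0.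
have [S' S'0 S'E] := bump_translate_horner vN.
have [C1 C10 hQ] := poly_comb_horner_lipschitz0 e Q.
have [C2 C20 hQ'] := poly_comb_horner_lipschitz0 e Q'.
have [C3 C30 hS] := poly_comb_horner_lipschitz0 e S.
have [C4 C40 hS'] := poly_comb_horner_lipschitz0 e S'.
pose C := (C1 + C4) + (C2 + C3).
have C0 : 0 <= C by rewrite !addr_ge0.
have [m Cm] := arch (divr_ge0 C0 (ltW eps0)).
pose n := m.+1; pose t : K := n%:R^-1.
have n0 : 0 < n%:R :> K by rewrite ltr0n.
have t0 : 0 < t by rewrite invr_gt0.
have tn0 : t != 0 by rewrite gt_eqF.
have tE : `|t| = t by rewrite gtr0_norm.
have t1 : `|t| <= 1 by rewrite tE invf_le1// ler1n.
have t1N : `|- t| <= 1 by rewrite normrN.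
have Ct : C * t < eps.
  rewrite ltr_pdivrMr// -ltr_pdivrMl// mulrC (lt_trans Cm)// ltr_nat.
  exact: ltnSn.
exists n, (bump N t u + (bump N (- t) v \Po ('X + (- t)^-1%:P))); split.
  rewrite S'E ?oppr_eq0// QE linearD /= -[u in _ - poly_comb e u]Q0 addrAC.
  have -> : poly_comb e S'.[(- t)%:P] =
      poly_comb e S'.[(- t)%:P] - poly_comb e S'.[0].
    by rewrite S'0 linear0 subr0.
  rewrite (le_lt_trans (ler_normD _ _))//.
  rewrite (le_lt_trans (lerD (hQ _ t1) (hS' _ t1N)))//.
  rewrite normrN tE -mulrDl (le_lt_trans _ Ct)// ler_wpM2r ?(ltW t0)//.
  by rewrite lerDl addr_ge0.
rewrite comp_polyD -comp_polyA comp_polyD comp_polyX comp_polyC.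
rewrite invrN invrK -addrA -polyCD subrr addr0 comp_polyXr bumpN//.
have -> : n%:R%:P = t^-1%:P :> {poly K} by rewrite invrK.
rewrite Q'E// SE linearD /= -[v in _ - poly_comb e v]S0 -addrA.
have -> : poly_comb e Q'.[t%:P] = poly_comb e Q'.[t%:P] - poly_comb e Q'.[0].
  by rewrite Q'0 linear0 subr0.
rewrite (le_lt_trans (ler_normD _ _))//.
rewrite (le_lt_trans (lerD (hQ' _ t1) (hS _ t1)))//.
rewrite tE -mulrDl (le_lt_trans _ Ct)// ler_wpM2r ?(ltW t0)//.
by rewrite lerDr addr_ge0.
Qed.

End Bump.

(** * Vectors with a dense orbit *)

Section HittingVector.
Variable K : numFieldType.
Hypothesis arch : forall x : K, 0 <= x -> exists n : nat, x < n%:R.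
Variables (X : completeNormedModType K) (T : {linear X -> X}) (C : K).
Hypothesis C0 : 0 < C.
Hypothesis TC : forall x, `|T x| <= C * `|x|.

Lemma pos_common_lower_bound (a b : K) : 0 < a -> 0 < b ->
  exists c, [/\ 0 < c, c <= a & c <= b].
Proof.
move=> a0 b0; have ab : 0 < a + b by rewrite addr_gt0.
exists (a * b / (a + b)); split; first by rewrite divr_gt0// mulr_gt0.
  by rewrite ler_pdivrMr// ler_pM2l// lerDr ltW.
by rewrite ler_pdivrMr// mulrC ler_pM2l// lerDl ltW.
Qed.

Lemma iter_lipschitz n x y :
  `|iter n T x - iter n T y| <= C ^+ n * `|x - y|.
Proof.
elim: n => [|n IH] /=; first by rewrite expr0 mul1r.
rewrite -linearB (le_trans (TC _))// exprS -mulrA.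
by rewrite ler_pM2l.
Qed.

(** Transitivity produces centres s_j in V and radii r_j, at least halved each
    time, with |s_(j+1) - s_j| <= r_j. The limit is then within 2 r_j of s_j for
    every j, and r_(j+1) is so small that some iterate of T carries the whole
    ball of radius 2 r_(j+1) around s_(j+1) close to t_j. *)
Lemma hitting_vector (V : set X) (t : nat -> X) :
  V !=set0 -> (forall j, V (t j)) ->
  (forall u v eps, V u -> V v -> 0 < eps -> exists n p,
    [/\ V p, `|p - u| < eps & `|iter n T p - v| < eps]) ->
  exists (s : nat -> X) (x : X), [/\ forall n, V (s n), s @ \oo --> x &
    forall j, exists n, `|iter n T x - t j| <= 1 / 2 ^+ j].
Proof.
move=> [v0 Vv0] Vt trans.
pose valid (a : X * K) := V a.1 /\ 0 < a.2.
pose step j (a b : X * K) := [/\ `|b.1 - a.1| <= a.2, b.2 <= a.2 / 2 &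
  exists n, forall y, `|y - b.1| <= 2 * b.2 ->
    `|iter n T y - t j| <= 1 / 2 ^+ j].
have /choice[nxt nxtP] (ja : nat * (X * K)) :
    exists b, valid ja.2 -> valid b /\ step ja.1 ja.2 b.
  case: ja => j [u r] /=.
  have [[/= Vu r0]|nv] := pselect (valid (u, r)); last first.
    by exists (u, r).
  have d0 : 0 < 1 / 2 ^+ j.+1 :> K by rewrite divr_gt0 ?exprn_gt0.
  have [eps [eps0 epsr epsd]] := pos_common_lower_bound r0 d0.
  have [n [p [Vp pu pt]]] := trans _ _ _ Vu (Vt j) eps0.
  have r20 : 0 < r / 2 by rewrite divr_gt0.
  have d'0 : 0 < 1 / 2 ^+ j.+1 / (C ^+ n * 2) :> K.
    by rewrite divr_gt0// mulr_gt0// exprn_gt0.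
  have [r' [r'0 r'r r'd]] := pos_common_lower_bound r20 d'0.
  exists (p, r') => _; split; first by split.
  split=> //=; first by rewrite (le_trans (ltW pu)).
  exists n => y yp; rewrite -(subrKA (iter n T p)) (le_trans (ler_normD _ _))//.
  have -> : 1 / 2 ^+ j = 1 / 2 ^+ j.+1 + 1 / 2 ^+ j.+1 :> K.
    rewrite exprS; field; by rewrite gt_eqF ?exprn_gt0.
  rewrite lerD ?(le_trans (ltW pt))// (le_trans (iter_lipschitz _ _ _))//.
  rewrite ler_pdivlMr in r'd; last by rewrite mulr_gt0// exprn_gt0.
  by rewrite (le_trans _ r'd)// [leRHS]mulrCA ler_pM2l ?exprn_gt0// mulrC.
pose a := fix a n := if n is m.+1 then nxt (m, a m) else (v0, 1) : X * K.
have av n : valid (a n).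
  elim: n => [|n IH] /=; first by split=> /=.
  by have [] := nxtP (n, a n) IH.
have astep n : step n (a n) (a n.+1) by have [] := nxtP (n, a n) (av n).
have rE j m : (a (j + m)%N).2 <= (a j).2 / 2 ^+ m.
  elim: m => [|m IH]; first by rewrite addn0 expr0 divr1.
  have [_ h _] := astep (j + m)%N; rewrite addnS (le_trans h)//.
  by rewrite exprSr invfM mulrA ler_pM2r ?invr_gt0.
have ds j m : `|(a (j + m.+1)%N).1 - (a (j + m)%N).1| <= (a j).2 / 2 ^+ m.
  by have [h _ _] := astep (j + m)%N; rewrite addnS (le_trans h).
have /cvg_ex[x sx] : cvg ((fun n => (a n).1) @ \oo).
  exact: (geometric_cvg arch (ds 0%N)).
exists (fun n => (a n).1), x; split=> //; first by move=> n; have [] := av n.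
move=> j; have [_ _ [n]] := astep j; move=> /(_ x) h; exists n; apply: h.
have sx' : (fun m => (a (j.+1 + m)%N).1) @ \oo --> x.
  have := sx; rewrite -(cvg_shiftn j.+1 (fun n => (a n).1)).
  by under eq_fun do rewrite addnC.
by have := geometric_lim_dist (ds j.+1) sx'; rewrite addn0.
Qed.

End HittingVector.

(** Visiting at time j the point numbered by the 2-adic valuation of j returns
    to the k-th point at the times 2^k 3^N, for all N. *)
Lemma countable_cover_infinitely_often (T : Type) (D : set T) :
  countable D -> D !=set0 ->
  exists t : nat -> T, (forall j, D (t j)) /\
    forall x, D x -> forall N, exists2 j, (N <= j)%N & t j = x.
Proof.
move=> /pfcard_geP[->[]//|[d]] _.
exists (fun j => d (logn 2 j)); split=> [j|x Dx N]; first exact: funS.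
have [k _ <-] := 'surj_d Dx.
exists (2 ^ k * 3 ^ N)%N.
  rewrite (leq_trans (ltnW (ltn_expl N (isT : (1 < 3)%N))))// leq_pmull//.
  by rewrite expn_gt0.
by rewrite mulnC logn_Gauss ?pfactorK// coprimeXr.
Qed.

Theorem theorem2 (K : numFieldType) (hK : real_or_complex K)
    (X : completeNormedModType K)
    (hX : infinite_dimensional [set: X])
    (M : set X)
    (hMsub : linear_subspace M)
    (hMproper : M `<` [set: X])
    (hMinf : infinite_dimensional M)
    (hMsep : separable_set M)
    (hMclosed : closed M) :
  exists T : {linear X -> X}, bounded_operator T /\ M_hypercyclic M T.
Proof.
have arch := real_or_complex_archimedean hK.
have [D [Dc [DM MD]]] := hMsep.
have D0 : D !=set0.
  have [y [Dy _]] := MD _ (linear_subspace0 hMsub) setT filterT.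
  by exists y.
have [t [tD tinf]] := countable_cover_infinitely_often Dc D0.
(* With this weight the n-th functional is small against g n, which depends on
   the vectors before e n only. *)
pose W (s : seq X) : K :=
  `|\sum_(k < size s) 'C(size s, k)%:R *: s`_k| * 2 ^+ size s.
have W0 s : 0 <= W s by rewrite mulr_ge0// exprn_ge0.
have [e [f [Me fl fe fW te]]] := biorthogonal_system
  (bounded_functional_separation hK) hMsub hMinf (fun n => DM _ (tD n)) W0.
pose g n := \sum_(k < n) 'C(n, k)%:R *: e k.
have fg n x : `|f n x| * `|g n| <= `|x| / 2 ^+ n.
  rewrite ler_pdivlMr ?exprn_gt0// -mulrA (le_trans _ (fW n x))// ler_wpM2l//.
  rewrite /W size_mkseq le_eqVlt; apply/orP; left; apply/eqP.
  by congr (`|_| * _); apply: eq_bigr => k _; rewrite nth_mkseq.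
have [T [TC TS]] := nuclear_perturbation arch fl fg.
have Te m : T (e m) = \sum_(k < m.+1) 'C(m, k)%:R *: e k.
  rewrite big_ord_recr /= binn scale1r addrC -/(g m).
  apply: (cvg_unique _ (TS (e m))) => //.
  apply: cvg_near_cst; exists m.+1 => // n /= mn.
  congr (_ + _); rewrite (bigD1 (Ordinal mn))//= fe eqxx scale1r big1 ?addr0//.
  move=> i im; rewrite fe -[m in _ == m]/(val (Ordinal mn)) val_eqE.
  by rewrite (negbTE im) scale0r.
have Mg n : M (g n).
  by apply: (@linear_subspace_sum _ _ _ hMsub n (fun k => 'C(n, k)%:R)).
have TM x : M x -> M (T x).
  move=> Mx; apply: (closed_cvg M hMclosed _ _ (TS x)).
  apply: nearW => n; apply: linear_subspaceD => //.
  exact: (@linear_subspace_sum _ _ _ hMsub n (fun k => f k x)).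
have VM (p : {poly K}) : M (poly_comb e p).
  exact: (@linear_subspace_sum _ _ _ hMsub _ (fun k => p`_k)).
have tV j : range (poly_comb e) (t j).
  have [c ->] := te j; exists (\sum_(i < j.+1) c i *: 'X^i) => //.
  rewrite linear_sum; apply: eq_bigr => i _; by rewrite linearZ /= poly_combXn.
have trans u v eps :
    range (poly_comb e) u -> range (poly_comb e) v -> 0 < eps ->
    exists n p, [/\ range (poly_comb e) p, `|p - u| < eps &
      `|iter n T p - v| < eps].
  move=> [p _ <-] [q _ <-] eps0.
  have [n [r [rp rq]]] := poly_comb_transitive arch e p q eps0.
  exists n, (poly_comb e r); split=> //.
  by rewrite (poly_comb_translate_iter Te).
have V0 : range (poly_comb e) !=set0 by exists (t 0%N); exact: tV.
have three : 0 < 3 :> K by [].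
have [s [x [sV sx hit]]] := hitting_vector arch three TC V0 tV trans.
have Mx : M x.
  apply: (closed_cvg M hMclosed _ _ sx); apply: nearW => n.
  by have [p _ <-] := sV n.
have Mit n : M (iter n T x) by elim: n => //= n; exact: TM.
exists T; split; first by exists 3.
exists x; split=> [y []//|y My B /nbhs_ballP[eps /= eps0 epsB]].
have eps20 : 0 < eps / 2 by rewrite divr_gt0.
have [z [Dz]] := MD y My _ (nbhsx_ballx y (eps / 2) eps20).
rewrite -ball_normE /= => yz.
have [N hN] := half_expr_small arch ler01 eps20.
have [j Nj tj] := tinf z Dz N.
have [n hn] := hit j; exists (iter n T x); split.
  by split; [exists n|exact: Mit].
apply: epsB; rewrite -ball_normE /= -(subrKA z) (le_lt_trans (ler_normD _ _))//.
rewrite [ltRHS](splitr eps) ltrD// distrC -tj (le_lt_trans hn)//.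
exact: hN.
Qed.
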